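(* For the single-cache file-bundle caching problem with cache size $k$ and queries of length $l$, the farthest-in-future (FF) algorithm achieves an approximation factor of at most $2l$ compared to the optimal offline algorithm: there is a constant $c$ independent of $\sigma$ such that for every query sequence $\sigma$, $\mathrm{FF}(\sigma)\le 2l\cdot\mathrm{OPT}(\sigma)+c$.
   Context: File-bundle caching: pages $\mathcal{O}=\{1,\dots,N\}$; a single cache with content $C_t\subset\mathcal{O}$, $|C_t|=k$; at each time $t$ a query $Q_t\subset\mathcal{O}$ with $|Q_t|=l$ arrives; a cache miss (unit cost) occurs if $Q_t\not\subseteq C_t$, in which case the cache must insert the pages of $Q_t$ by evicting some pages; no other changes are allowed. $\mathrm{OPT}(\sigma)$ is the minimum number of cache misses achievable on $\sigma$ with full knowledge of the sequence. The farthest-in-future (FF) algorithm knows all future queries and, whenever evictions are needed, evicts the cache pages whose next request lies farthest in the future. *)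

(* Defs.v *)
From mathcomp Require Import all_boot.

Set Implicit Arguments.
Unset Strict Implicit.
Unset Printing Implicit Defensive.

Section FileBundleCaching.

Variable N : nat.

Definition page := 'I_N.
Definition cache := {set page}.
Definition query := {set page}.

Implicit Types (C D : cache) (Q : query) (sigma : seq query) (cs : seq cache).

Definition queries_of_length (l : nat) sigma : bool :=
  all (fun Q => #|Q| == l) sigma.

Definition miss C Q : bool := ~~ (Q \subset C).

(* [D] may be the content right after [Q] is served from the content [C].     *)
(* On a miss the pages of [Q] are inserted and nothing else enters the cache, *)
(* so that exactly #|Q :\: C| pages of [C] are evicted, none of them in [Q].  *)
Definition serves (k : nat) C Q D : bool :=
  if miss C Q then [&& Q \subset D, D \subset C :|: Q & #|D| == k]
  else D == C.

(* [cs] lists the contents after each query; [C] is the content before the    *)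
(* first one.                                                                 *)
Fixpoint schedule (k : nat) C sigma cs : bool :=
  match sigma, cs with
  | [::], [::] => true
  | Q :: sigma', D :: cs' => serves k C Q D && schedule k D sigma' cs'
  | _, _ => false
  end.

Fixpoint misses C sigma cs : nat :=
  match sigma, cs with
  | Q :: sigma', D :: cs' => miss C Q + misses D sigma' cs'
  | _, _ => 0
  end.

(* The default value [size sigma] bounds the cost of every schedule, so it is *)
(* harmless as soon as some schedule exists; see [OPT_min] and [OPT_attained].*)
Definition OPT (k : nat) C sigma : nat :=
  \big[minn/size sigma]_(cs : (size sigma).-tuple cache | schedule k C sigma cs)
    misses C sigma cs.

(* Position in [future] of the first query containing [p]. A page that is     *)
(* never requested again gets [size future], beyond all actual positions.     *)
Definition next_request (future : seq query) (p : page) : nat :=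
  find (fun Q : query => p \in Q) future.

(* Pages of [C] lying in [Q] cannot be evicted, so evicted pages are compared *)
(* with the kept pages of [C] outside [Q]. Ties, which are unavoidable since  *)
(* the pages of one query share the same request time, are left unresolved.   *)
Definition FF_serves (k : nat) C Q (future : seq query) D : bool :=
  serves k C Q D &&
  [forall p in C :\: D, forall q in (C :&: D) :\: Q,
     next_request future q <= next_request future p].

Fixpoint FF_schedule (k : nat) C sigma cs : bool :=
  match sigma, cs with
  | [::], [::] => true
  | Q :: sigma', D :: cs' =>
      FF_serves k C Q sigma' D && FF_schedule k D sigma' cs'
  | _, _ => false
  end.

Lemma FF_schedule_schedule k C sigma cs :
  FF_schedule k C sigma cs -> schedule k C sigma cs.
Proof.
elim: sigma C cs => [|Q s IH] C [|D cs] //= /andP[/andP[-> _] /IH ->] //.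
Qed.

Lemma size_schedule k C sigma cs :
  schedule k C sigma cs -> size cs = size sigma.
Proof. by elim: sigma C cs => [|Q s IH] C [|D cs] //= /andP[_ /IH ->]. Qed.

Lemma misses_le_size C sigma cs : misses C sigma cs <= size sigma.
Proof.
elim: sigma C cs => [|Q s IH] C [|D cs] //=.
by rewrite -addn1 addnC leq_add // leq_b1.
Qed.

Lemma FF_serves_exists k C Q (future : seq query) :
  #|C| = k -> #|Q| <= k ->
  exists D, FF_serves k C Q future D && (#|D| == k).
Proof.
move=> cC cQ; rewrite /FF_serves /serves.
have [m|h] := boolP (miss C Q); last first.
  exists C; rewrite eqxx cC eqxx !andbT /=.
  by apply/forall_inP => p; rewrite setDv inE.
pose r := [rel p q : page | next_request future q <= next_request future p].
have r_tot : total r by move=> p q; apply: leq_total.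
have r_tr : transitive r by move=> q p s /= ? H; apply: leq_trans H _.
pose s := sort r (enum (C :\: Q)).
have s_mem p : (p \in s) = (p \in C :\: Q) by rewrite mem_sort mem_enum.
have s_uniq : uniq s by rewrite sort_uniq enum_uniq.
have s_sort : sorted r s by apply: sort_sorted.
have s_size : size s = #|C :\: Q| by rewrite size_sort -cardE.
pose n := #|Q :\: C|.
have cardE1 : #|C :\: Q| + #|C :&: Q| = k by rewrite addnC cardsID.
have cardE2 : n + #|C :&: Q| = #|Q| by rewrite addnC setIC cardsID.
have n_le : n <= size s.
  by rewrite s_size -(leq_add2r #|C :&: Q|) cardE1 cardE2.
pose K := [set p in drop n s].
have KsubP p : p \in K -> p \in C :\: Q by rewrite inE => /mem_drop; rewrite s_mem.
have cK : #|K| = #|C :\: Q| - n.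
  by rewrite cardsE (card_uniqP (drop_uniq n s_uniq)) size_drop s_size.
have KQ : K :&: Q = set0.
  apply/setP=> p; rewrite !in_setI in_set0; apply/negbTE/negP => /andP[/KsubP].
  by rewrite inE => /andP[/negbTE ->].
have cD : #|K :|: Q| = k.
  rewrite cardsU KQ cards0 subn0 cK -cardE2 addnA subnK ?cardE1 //.
  by rewrite -s_size.
exists (K :|: Q); rewrite subsetUr cD eqxx !andbT /=; apply/andP; split.
  by apply: setSU; apply/subsetP=> p /KsubP; rewrite inE => /andP[].
apply/forall_inP => p; rewrite !inE negb_or => /andP[/andP[pK pQ] pC].
apply/forall_inP => q; rewrite !inE => /andP[qQ /andP[qC]].
rewrite (negbTE qQ) orbF => qK.
have ps : p \in take n s.
  have : p \in s by rewrite s_mem inE pQ pC.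
  by rewrite -{1}(cat_take_drop n s) mem_cat (negbTE pK) orbF.
move: s_sort; rewrite (sorted_pairwise r_tr) -(cat_take_drop n s) pairwise_cat.
by move=> /andP[/allrelP H _]; apply: H.
Qed.

Lemma FF_schedule_exists k l C sigma :
  l <= k -> #|C| = k -> queries_of_length l sigma ->
  exists cs, FF_schedule k C sigma cs.
Proof.
move=> lk; elim: sigma C => [|Q s IH] C cC /=; first by exists [::].
case/andP=> /eqP cQ hs; have cQk : #|Q| <= k by rewrite cQ.
have [D /andP[FD /eqP cD]] := FF_serves_exists s cC cQk.
by have [cs Hcs] := IH D cD hs; exists (D :: cs); rewrite /= FD.
Qed.

Lemma OPT_min k C sigma cs :
  schedule k C sigma cs -> OPT k C sigma <= misses C sigma cs.
Proof.
move=> H; have /eqP sz := size_schedule H; rewrite /OPT.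
have := mem_index_enum (Tuple sz); elim: (index_enum _) => //= t r IH.
rewrite inE big_cons => /predU1P[<- | /IH {}IH]; first by rewrite H geq_minl.
by case: ifP => // _; apply: leq_trans IH; apply: geq_minr.
Qed.

Lemma OPT_attained k l C sigma :
  l <= k -> #|C| = k -> queries_of_length l sigma ->
  exists2 cs, schedule k C sigma cs & misses C sigma cs = OPT k C sigma.
Proof.
move=> lk cC hs.
have [cs0 /FF_schedule_schedule H0] := FF_schedule_exists lk cC hs.
have: OPT k C sigma = size sigma \/
    exists2 cs, schedule k C sigma cs & misses C sigma cs = OPT k C sigma.
  rewrite /OPT; elim/big_ind: _ => [|x y IHx IHy|cs Hcs]; first by left.
    by rewrite /minn; case: ifP.
  by right; exists cs.
case=> // E; exists cs0 => //; apply/eqP.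
by rewrite eqn_leq (OPT_min H0) E misses_le_size.
Qed.

End FileBundleCaching.

(* Main.v *)
Require Import Defs.
From mathcomp Require Import all_boot.
From mathcomp Require Import zify.

(**
FF minimises, up to an additive constant, the number of loaded pages: each miss
loads at least one and at most [l] pages, so FF misses at most [l] times as
often as OPT, up to that constant. Let [near s t C] be the number of pages of
[C] requested within the first [t] queries of [s]. The potential is the least
[phi] such that [near s t D <= near s t C + phi] for all [t], where [C] and [D]
are the contents of FF and of OPT. Serving a query [Q] changes the potential by
at most [#|Q :\: D| - #|Q :\: C|], because FF retains the [k - l] pages of
[C :\: Q] that are requested first.
*)

Set Implicit Arguments.
Unset Strict Implicit.
Unset Printing Implicit Defensive.

Section FarthestInFuture.

Variables (N k : nat).

Implicit Types (C D : cache N) (Q : query N) (s : seq (query N)).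

Definition near s (t : nat) C : nat := #|[set p in C | next_request s p < t]|.

Lemma near_le_card s t C : near s t C <= #|C|.
Proof. by apply/subset_leq_card/subsetP=> p; rewrite inE => /andP[]. Qed.

Lemma near_mono s t C D : C \subset D -> near s t C <= near s t D.
Proof.
move=> /subsetP sCD; apply/subset_leq_card/subsetP=> p.
by rewrite !inE => /andP[/sCD-> ->].
Qed.

Lemma near_setID s t C Q : near s t C = near s t (C :&: Q) + near s t (C :\: Q).
Proof.
rewrite /near -(cardsID Q [set p in C | _]); congr (_ + _); apply: eq_card => p.
  by rewrite !inE andbAC.
by rewrite !inE andbA.
Qed.

Lemma near_cons Q s t C :
  near (Q :: s) t.+1 C = #|C :&: Q| + near s t (C :\: Q).
Proof.
rewrite (near_setID _ _ _ Q) /near /next_request /=; congr (_ + _).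
  apply: eq_card => p; rewrite !inE.
  by case: (p \in C); case: (p \in Q).
apply: eq_card => p; rewrite !inE.
by case: (p \in C); case: (p \in Q).
Qed.

Lemma near_sup s t C Q :
  Q \subset C -> near s t C = near s t Q + near s t (C :\: Q).
Proof. by move=> /setIidPr sQC; rewrite (near_setID _ _ _ Q) sQC. Qed.

(** Hits and misses get one common description, so the main induction need not split on [miss]. *)
Lemma servesP C Q D : #|C| = k -> serves k C Q D ->
  [/\ Q \subset D, D :\: Q \subset C :\: Q & #|D| = k].
Proof.
rewrite /serves /miss => cC; case: ifPn => [_ /and3P[sQD sDCQ /eqP cD] | ].
  by split=> //; apply: subset_trans (setSD Q sDCQ) _; rewrite setDUl setDv setU0.
by rewrite negbK => sQC /eqP->.
Qed.

(** If FF evicts a page requested before [t], every page it keeps outside [Q] is requested at least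
    as early, hence also before [t]. Otherwise no page counted by [near s t] is lost. *)
Lemma FF_serves_near C Q s D t : #|C| = k -> FF_serves k C Q s D ->
  near s t (C :\: Q) <= near s t (D :\: Q) \/ #|D :\: Q| <= near s t (D :\: Q).
Proof.
move=> cC /andP[sv /forall_inP far].
have [sQD /subsetP sDC _] := servesP cC sv.
have [/existsP[p /andP[pCD pt]]|none] :=
    boolP [exists p, (p \in C :\: D) && (next_request s p < t)].
  right; apply/subset_leq_card/subsetP=> q qDQ; rewrite inE qDQ /=.
  have /forall_inP/(_ q) := far p pCD; have := sDC q qDQ; move: qDQ.
  rewrite !inE => /andP[_ ->] /andP[-> ->] /(_ isT) le_qp.
  exact: leq_ltn_trans le_qp pt.
left; apply/subset_leq_card/subsetP=> p; rewrite !inE => /andP[/andP[-> pC] pt].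
rewrite pt andbT /=; apply: contraNT none => pD.
by apply/existsP; exists p; rewrite !inE pD pC.
Qed.

Lemma miss_le_load C Q : miss C Q <= #|Q :\: C|.
Proof. by rewrite /miss -setD_eq0 -card_gt0; case: #|_|. Qed.

Lemma load_le_miss C Q : #|Q :\: C| <= #|Q| * miss C Q.
Proof.
rewrite /miss; have [sQC|_] /= := boolP (Q \subset C).
  by move: sQC; rewrite -setD_eq0 => /eqP->; rewrite cards0.
by rewrite muln1 subset_leq_card ?subsetDl.
Qed.

Lemma FF_misses_le l s C D cs ds phi :
  #|C| = k -> #|D| = k -> queries_of_length l s ->
  FF_schedule k C s cs -> schedule k D s ds ->
  (forall t, near s t D <= near s t C + phi) ->
  misses C s cs <= l * misses D s ds + phi.
Proof.
elim: s C D cs ds phi => [|Q s IH] C D [|C' cs] [|D' ds] phi //= cC cD.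
move=> /andP[/eqP cQ ls] /andP[FC FFcs] /andP[sD Sds] domi.
have [sQC' sC' cC'] := servesP cC (proj1 (andP FC)).
have [sQD' sD' cD'] := servesP cD sD.
have loadC := cardsID C Q; have loadD := cardsID D Q.
rewrite setIC cQ in loadC; rewrite setIC cQ in loadD.
have restC : #|C' :\: Q| = k - l by rewrite cardsD (setIidPr sQC') cC' cQ.
have restD : #|D' :\: Q| = k - l by rewrite cardsD (setIidPr sQD') cD' cQ.
have none A : near s 0 A = 0 by apply: eq_card0 => p; rewrite !inE andbF.
(* Horizon 1 sees only [Q]: this gives [#|Q :\: C| <= phi + #|Q :\: D|], so the subtraction in the
   new potential does not truncate. *)
have dom0 := domi 1; rewrite !near_cons !none in dom0.
have missC := miss_le_load C Q; have missD := load_le_miss D Q.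
rewrite cQ in missD.
have {IH} : misses C' s cs <=
    l * misses D' s ds + (phi + #|Q :\: D| - #|Q :\: C|).
  apply: IH => // t; rewrite (near_sup _ _ sQC') (near_sup _ _ sQD').
  have := domi t.+1; rewrite !near_cons.
  have := near_mono s t sD'; have := near_le_card s t (D' :\: Q).
  (* Either [domi] at [t.+1] carries over, or all [k - l] pages of [C' :\: Q] are near, which is the
     most that [D' :\: Q] can reach. *)
  have := FF_serves_near t cC FC.
  by rewrite restC restD; lia.
(* The loads [#|Q :\: C|] pay for a miss of FF and cancel against the potential; [#|Q :\: D|] is at
   most [l * miss D Q]. *)
by rewrite mulnDr; lia.
Qed.

End FarthestInFuture.

Theorem theorem8p3 (N k l : nat) (hlk : l <= k) :
  exists c : nat,
    forall (C0 D0 : cache N) (sigma : seq (query N)) (cs : seq (cache N)),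
      #|C0| = k -> #|D0| = k ->
      queries_of_length l sigma ->
      FF_schedule k C0 sigma cs ->
      misses C0 sigma cs <= 2 * l * OPT k D0 sigma + c.
Proof.
(* The initial contents may differ, but [near] never exceeds [k], so the initial potential is at
   most [k]. *)
exists k => C D s cs cC cD ls FF.
have [ds Sds <-] := OPT_attained hlk cD ls.
apply: leq_trans (FF_misses_le (phi := k) cC cD ls FF Sds _) _ => [t|].
  by apply: leq_trans (near_le_card _ _ _) _; rewrite cD leq_addl.
by rewrite leq_add2r leq_mul2r leq_pmull ?orbT.
Qed.
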